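(* For all integers $n\geq 1$ one has $\lambda_n(n)=\nu_n(n)=\gamma_n(n)=1$, and for all $k=1,\dots,n-1$, $$\lambda_k(n)=\nu_k(n)+\lambda_{k+1}(n),\qquad \nu_k(n)=\gamma_k(n)+\nu_{k+1}(n).$$
   Context: A partition of $n$ is a finite decreasing sequence $\lambda=(\lambda_1\geq\dots\geq\lambda_s>0)$ of positive integers (parts) with sum $\vert\lambda\vert=n$. To a partition $\lambda$ of $n$ one associates three vectors in $\mathbf{Z}^n$: (1) the vector $(\lambda_1,\dots,\lambda_n)$, where $\lambda_k=0$ for $k$ larger than the number of parts; (2) the vector $\nu=(\nu_1,\dots,\nu_n)$, where $\nu_i$ is the number of parts of $\lambda$ equal to $i$; (3) the vector $\gamma=(\gamma_1,\dots,\gamma_n)$, where $\gamma_i$ is the number of indices $j\in\{1,\dots,n\}$ with $\nu_j=i$. The integers $\lambda_k(n),\nu_k(n),\gamma_k(n)$ (for $1\leq k\leq n$) are obtained by summing over all partitions of $n$: $\lambda_k(n)=\sum_{\vert\lambda\vert=n}\lambda_k$, $\nu_k(n)=\sum_{\vert\lambda\vert=n}\nu_k$, $\gamma_k(n)=\sum_{\vert\lambda\vert=n}\gamma_k$. *)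

(* Defs.v *)
From HB Require Import structures.
From mathcomp Require Import all_boot.

Set Implicit Arguments.
Unset Strict Implicit.
Unset Printing Implicit Defensive.

Definition is_intpart (n : nat) (s : seq nat) : bool :=
  [&& sorted geq s, all (fun p => 0 < p) s & sumn s == n].

Record intpart (n : nat) : Type :=
  IntPart { parts :> seq nat; _ : is_intpart n parts }.

HB.instance Definition _ (n : nat) := [isSub for @parts n].
HB.instance Definition _ (n : nat) := [Countable of intpart n by <:].

(* Finiteness of [intpart n]: a partition of n has at most n parts, each at
   most n, so it embeds into the finite type of sequences of length at most n
   over 'I_n.+1. *)
Lemma intpart_size (n : nat) (l : intpart n) : size l <= n.
Proof.
case: l => s /= /and3P[_ + /eqP <-].
elim: s => //= p s IHs /andP[p_gt0 /IHs].
by rewrite -add1n; apply: leq_add.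
Qed.

Lemma intpart_leq (n : nat) (l : intpart n) (p : nat) : p \in parts l -> p <= n.
Proof.
case: l => s /= /and3P[_ _ /eqP <-].
elim: s => //= q s IHs; rewrite inE => /predU1P[->|/IHs]; first exact: leq_addr.
by move=> /leq_trans; apply; apply: leq_addl.
Qed.

Lemma intpart_encode_subproof (n : nat) (l : intpart n) :
  size (map (@inord n) l) <= n.
Proof. by rewrite size_map intpart_size. Qed.

Definition intpart_encode (n : nat) (l : intpart n) : n.-bseq 'I_n.+1 :=
  Bseq (intpart_encode_subproof l).

Definition intpart_decode (n : nat) (b : n.-bseq 'I_n.+1) : option (intpart n) :=
  insub (map val b).

Lemma intpart_encodeK (n : nat) : pcancel (@intpart_encode n) (@intpart_decode n).
Proof.
move=> l; rewrite /intpart_decode /= -map_comp.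
have -> : [seq (val \o @inord n) p | p <- l] = parts l.
  by rewrite -[RHS]map_id; apply/eq_in_map => p /intpart_leq lepn /=; rewrite inordK.
exact: valK.
Qed.

HB.instance Definition _ (n : nat) : isFinite (intpart n) :=
  PCanIsFinite (@intpart_encodeK n).

(* [part_k], [mult_k], [multmult_k] are the coordinates lambda_k, nu_k, gamma_k
   of the three vectors in Z^n attached to a partition l of n.  The index k is
   1-based (whence [k.-1] below) and only 1 <= k <= n is meaningful. *)
Definition part_k (n : nat) (l : intpart n) (k : nat) : nat := nth 0 l k.-1.

Definition mult_k (n : nat) (l : intpart n) (k : nat) : nat := count_mem k l.

Definition multmult_k (n : nat) (l : intpart n) (k : nat) : nat :=
  count (fun j => mult_k l j == k) (iota 1 n).

Definition lambda_sum (n k : nat) : nat := \sum_(l : intpart n) part_k l k.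
Definition nu_sum (n k : nat) : nat := \sum_(l : intpart n) mult_k l k.
Definition gamma_sum (n k : nat) : nat := \sum_(l : intpart n) multmult_k l k.

(* Main.v *)
Require Import Defs.
From mathcomp Require Import all_boot.
From mathcomp Require Import zify.

(** Both recurrences come from bijections on the partitions of [n], and both
    hold for every [k >= 1].

    For the first one, let [l'] be the conjugate of [l], so that the [k]-th part
    of [l] counts the parts of [l'] that are at least [k].  Hence the number of
    parts of [l'] equal to [k] is [part_k l k - part_k l k.+1]
    ([count_mem_transpose]).  Conjugation permutes the partitions of [n], and
    summing over [l] gives [lambda_k(n) - lambda_(k+1)(n) = nu_k(n)].

    For the second one, let [N(j, k)] be the number of partitions of [n] having
    at least [k] parts equal to [j].  Trading [k] parts equal to [j] for [j]
    parts equal to [k] preserves the sum, so [N(j, k) = N(k, j)]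
    ([card_mult_geC]).  Counting each multiplicity by its lower bounds gives
    [nu_k(n) = \sum_j N(k, j)], which is therefore [\sum_j N(j, k)].  On the
    other hand exactly [N(j, k) - N(j, k+1)] partitions have exactly [k] parts
    equal to [j], and summing over [j] gives
    [gamma_k(n) = nu_k(n) - nu_(k+1)(n)].

    Finally [nu_n(n) = 1], since only the partition with the single part [n] has
    a part equal to [n]; the other two initial values follow from the
    recurrences at [k = n], because [lambda_(n+1)(n) = nu_(n+1)(n) = 0]. *)

Set Implicit Arguments.
Unset Strict Implicit.
Unset Printing Implicit Defensive.

Lemma intpart_sorted n (l : intpart n) : sorted geq l.
Proof. by case: l => s /= /and3P[]. Qed.

Lemma intpart_gt0 n (l : intpart n) : all (fun p => 0 < p) l.
Proof. by case: l => s /= /and3P[]. Qed.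

Lemma intpart_sumn n (l : intpart n) : sumn l = n.
Proof. by case: l => s /= /and3P[_ _ /eqP]. Qed.

Lemma geq_trans : transitive geq.
Proof. by move=> a b c; rewrite /geq /= => ab /leq_trans; apply. Qed.

Lemma geq_total : total geq.
Proof. by move=> a b; rewrite /geq /= leq_total. Qed.

Lemma intpart_perm_inj n (l m : intpart n) : perm_eq l m -> l = m.
Proof.
move=> lm; apply/val_inj/(sorted_eq geq_trans) => //; try exact: intpart_sorted.
by move=> a b; rewrite /geq /= => ab; apply/eqP; rewrite eqn_leq andbC.
Qed.

(** * Conjugation *)

Definition transpose (s : seq nat) : seq nat :=
  [seq count (ltn i) s | i <- iota 0 (head 0 s)].

(** The two sides say that the cell in row [k] and column [i] belongs to the
    Young diagram of [s], read along columns and along rows. *)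
Lemma count_ltn_sorted (s : seq nat) i k :
  sorted geq s -> (k < count (ltn i) s) = (i < nth 0 s k).
Proof.
elim: s k => [|a s IHs] k /=; first by rewrite nth_nil.
move=> pas; have /allP sa := order_path_min geq_trans pas.
have [ia|ai] := ltnP i a.
  by case: k => [|k] //=; rewrite add1n ltnS IHs // (path_sorted pas).
have -> : count (ltn i) s = 0.
  apply/eqP; rewrite -leqn0 leqNgt -has_count; apply/hasPn => p /sa /=.
  by rewrite -leqNgt => /leq_trans; apply.
case: k => [|k] /=; first by rewrite [RHS]ltnNge ai.
have [ks|ks] := ltnP k (size s); last by rewrite nth_default.
by apply/esym/negbTE; rewrite -leqNgt (leq_trans _ ai) //; apply/sa/mem_nth.
Qed.

Lemma count_gtn_iota m h : count (gtn m) (iota 0 h) = minn m h.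
Proof.
elim: h => [|h IHh]; first by rewrite minn0.
by rewrite -addn1 iotaD count_cat IHh /=; lia.
Qed.

Lemma nth_le_head (s : seq nat) k : sorted geq s -> nth 0 s k <= head 0 s.
Proof.
case: s k => [|a s] [|k] //= pas; have [ks|ks] := ltnP k (size s).
  by have /allP := order_path_min geq_trans pas; apply; rewrite mem_nth.
by rewrite nth_default.
Qed.

(** The columns of the conjugate are the rows of [s]: this is the involutivity of
    conjugation, in the form that gives both its injectivity and the
    multiplicities of the conjugate. *)
Lemma count_ltn_transpose (s : seq nat) k :
  sorted geq s -> count (ltn k) (transpose s) = nth 0 s k.
Proof.
move=> ss; rewrite count_map -[RHS](minn_idPl (nth_le_head k ss)).
rewrite -count_gtn_iota; apply: eq_count => i /=.
exact: count_ltn_sorted.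
Qed.

Lemma count_mem_transpose (s : seq nat) k : sorted geq s ->
  nth 0 s k = count_mem k.+1 (transpose s) + nth 0 s k.+1.
Proof.
move=> ss; rewrite -!count_ltn_transpose // -count_predUI.
rewrite [X in _ = _ + X](@eq_count _ _ pred0) => [|p /=]; last by lia.
by rewrite count_pred0 addn0; apply: eq_count => p /=; lia.
Qed.

(** The cells of a Young diagram, counted by columns and by rows. *)
Lemma sumn_counts h (s : seq nat) : all (geq h) s ->
  sumn [seq count (ltn i) s | i <- iota 0 h] = sumn s.
Proof.
elim: s => [|p s IHs] /= => [_|/andP[ph /IHs <-]].
  by rewrite sumnE big_map big1.
rewrite !sumnE !big_map big_split /=; congr (_ + _).
rewrite -[RHS](minn_idPl ph) -count_gtn_iota -sumn_count sumnE big_map.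
exact: eq_bigr.
Qed.

Lemma transpose_subproof n (l : intpart n) : is_intpart n (transpose l).
Proof.
have ss := intpart_sorted l; apply/and3P; split.
- rewrite sorted_map; apply: sub_sorted (iota_ltn_sorted 0 _) => i j /= ij.
  by apply: sub_count => p /=; apply: ltn_trans.
- rewrite all_map; apply/allP => i; rewrite mem_iota add0n /= => ih.
  by rewrite count_ltn_sorted // nth0.
rewrite -[X in _ == X](intpart_sumn l) sumn_counts //.
by apply/allP => p /(nthP 0)[k _ <-] /=; apply: nth_le_head.
Qed.

Definition conjugate n (l : intpart n) : intpart n :=
  IntPart (transpose_subproof l).

Lemma eq_from_nth_gt0 (s t : seq nat) :
  all (fun p => 0 < p) s -> all (fun p => 0 < p) t ->
  nth 0 s =1 nth 0 t -> s = t.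
Proof.
elim: s t => [|a s IHs] [|b t] //=.
- by move=> _ /andP[b0 _] /(_ 0) /= ab; rewrite -ab in b0.
- by move=> /andP[a0 _] _ /(_ 0) /= ab; rewrite ab in a0.
move=> /andP[_ s0] /andP[_ t0] st; rewrite (st 0 : a = b).
by rewrite (IHs t) // => k; apply: (st k.+1).
Qed.

Lemma conjugate_inj n : injective (@conjugate n).
Proof.
move=> l m /(congr1 (@parts n)) /= lm; apply: val_inj.
apply: eq_from_nth_gt0; try exact: intpart_gt0.
by move=> k; rewrite -!count_ltn_transpose ?intpart_sorted // lm.
Qed.

Lemma lambda_sum_rec n k : 0 < k ->
  lambda_sum n k = nu_sum n k + lambda_sum n k.+1.
Proof.
case: k => // k _; rewrite /nu_sum (reindex_inj (@conjugate_inj n)) -big_split.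
by apply: eq_bigr => l _; apply/count_mem_transpose/intpart_sorted.
Qed.

(** * Trading k parts equal to j for j parts equal to k *)

Definition exchange (j k : nat) (s : seq nat) : seq nat :=
  sort geq (nseq j k ++ (drop k (filter (pred1 j) s) ++ filter (predC1 j) s)).

(** Allowing an arbitrary predicate [a], and not only a multiplicity, makes the
    identity say that two multisets are equal, as [perm_exchange] does. Adding
    the removed and the new parts on opposite sides avoids subtraction. *)
Lemma count_exchange j k (s : seq nat) (a : pred nat) : k <= count_mem j s ->
  a j * k + count a (exchange j k s) = a k * j + count a s.
Proof.
move=> kj; rewrite (permP (permEl (perm_sort _ _))) !count_cat count_nseq addnCA.
congr (_ + _).
rewrite -(permP (permEl (perm_filterC (pred1 j) s)) a) count_cat addnA.
congr (_ + _); rewrite -[in RHS](cat_take_drop k (filter _ s)) count_cat.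
congr (_ + _); have /all_pred1P -> := filter_all (pred1 j) s.
by rewrite size_filter take_nseq // count_nseq.
Qed.

Lemma perm_exchange j k (s : seq nat) : k <= count_mem j s ->
  perm_eq (nseq k j ++ exchange j k s) (nseq j k ++ s).
Proof.
by move=> kj; apply/permP => a; rewrite !count_cat !count_nseq count_exchange.
Qed.

Lemma exchange_subproof n j k (l : intpart n) :
  0 < k -> k <= count_mem j l -> is_intpart n (exchange j k l).
Proof.
move=> k0 kj; have pe := perm_exchange kj; apply/and3P; split.
- exact: (sort_sorted geq_total).
- have /=: all (fun p => 0 < p) (nseq j k ++ l).
    by rewrite all_cat intpart_gt0 all_nseq k0 orbT.
  by rewrite -(perm_all _ pe) all_cat => /andP[].
have := perm_sumn pe; rewrite !sumn_cat !sumn_nseq intpart_sumn mulnC.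
by move/eqP; rewrite eqn_add2l.
Qed.

Definition mult_ge n j k : {set intpart n} := [set l | k <= mult_k l j].

(** The exchange is injective because [l] is recovered, up to the order of its
    parts, from [exchange j k l] by [perm_exchange]. One inequality is enough:
    swapping [j] and [k] gives the other. *)
Lemma leq_card_mult_ge n j k : 0 < k -> #|mult_ge n j k| <= #|mult_ge n k j|.
Proof.
(* The default value [l] is only taken outside [mult_ge n j k]. *)
move=> k0; pose f (l : intpart n) := insubd l (exchange j k l).
have fE l : l \in mult_ge n j k -> parts (f l) = exchange j k l.
  by rewrite inE => kj; rewrite (insubdK l) //; apply: exchange_subproof.
have f_inj : {in mult_ge n j k &, injective f}.
  move=> l m lA mA fl; apply: intpart_perm_inj.
  rewrite -(perm_cat2l (nseq j k)) perm_sym.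
  move: (lA) (mA); rewrite !inE => /perm_exchange pl /perm_exchange pm.
  by rewrite -(permPl pm) -(permPr pl) -!fE // fl.
rewrite -(card_in_imset f_inj); apply/subset_leq_card/subsetP => m.
move=> /imsetP[l lA ->]; rewrite inE /mult_k fE //.
rewrite (permP (permEl (perm_sort _ _))) count_cat count_nseq /= eqxx mul1n.
exact: leq_addr.
Qed.

Lemma card_mult_geC n j k : 0 < j -> 0 < k ->
  #|mult_ge n j k| = #|mult_ge n k j|.
Proof. by move=> j0 k0; apply/eqP; rewrite eqn_leq !leq_card_mult_ge. Qed.

Lemma card_mult_geE n j k :
  #|mult_ge n j k| = \sum_(l : intpart n) (k <= mult_k l j).
Proof. by rewrite -sum1dep_card big_mkcond; apply: eq_bigr => l _; case: leq. Qed.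

Lemma count_geq_iota1 m h : m <= h -> count (geq m) (iota 1 h) = m.
Proof.
move=> mh; rewrite -[RHS](minn_idPl mh) -count_gtn_iota.
by rewrite (iotaDl 1 0) count_map; apply: eq_count.
Qed.

(** A multiplicity is the number of its positive lower bounds; those up to [n]
    suffice, as a partition of [n] has at most [n] parts. *)
Lemma nu_sumE n k : nu_sum n k = \sum_(j <- iota 1 n) #|mult_ge n k j|.
Proof.
under eq_bigr do rewrite card_mult_geE.
rewrite exchange_big; apply: eq_bigr => l _ /=.
have le_n : mult_k l k <= n.
  by apply: leq_trans (count_size _ _) (intpart_size l).
rewrite -[LHS](count_geq_iota1 le_n) -sumn_count sumnE big_map.
exact: eq_bigr.
Qed.

Lemma nu_sum_transposed n k : 0 < k ->
  nu_sum n k = \sum_(j <- iota 1 n) #|mult_ge n j k|.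
Proof.
move=> k0; rewrite nu_sumE; apply: eq_big_seq => j.
by rewrite mem_iota => /andP[j0 _]; apply: card_mult_geC.
Qed.

Lemma gamma_sumE n k : gamma_sum n k =
  \sum_(j <- iota 1 n) \sum_(l : intpart n) (mult_k l j == k).
Proof.
rewrite exchange_big; apply: eq_bigr => l _ /=.
by rewrite /multmult_k -sumn_count sumnE big_map.
Qed.

Lemma nu_sum_rec n k : 0 < k -> nu_sum n k = gamma_sum n k + nu_sum n k.+1.
Proof.
move=> k0; rewrite gamma_sumE !nu_sum_transposed // -big_split.
apply: eq_bigr => j _ /=; rewrite !card_mult_geE -big_split.
by apply: eq_bigr => l _ /=; lia.
Qed.

(** * Initial values *)

Lemma lambda_sum_gt n : lambda_sum n n.+1 = 0.
Proof. by apply: big1 => l _; rewrite /part_k nth_default ?intpart_size. Qed.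

Lemma nu_sum_gt n : nu_sum n n.+1 = 0.
Proof.
apply: big1 => l _; apply/count_memPn; apply/negP => /intpart_leq.
by rewrite ltnn.
Qed.

Lemma intpart1_subproof n : 0 < n -> is_intpart n [:: n].
Proof. by move=> n0; rewrite /is_intpart /= n0 addn0 eqxx. Qed.

Lemma intpart_mem_max n (l : intpart n) : n \in parts l -> parts l = [:: n].
Proof.
move=> nl; have pl := perm_to_rem nl.
(* The parts other than [n] are positive with sum zero, so there are none. *)
have r0 : sumn (rem n l) = 0.
  by have := perm_sumn pl; rewrite intpart_sumn /=; lia.
have ra : all (fun p => 0 < p) (rem n l).
  by have := intpart_gt0 l; rewrite (perm_all _ pl) /= => /andP[].
have rnil : rem n l = [::].
  by case: (rem n l) r0 ra => //= p s; case: p.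
by rewrite rnil in pl; apply: perm_small_eq pl.
Qed.

Lemma nu_sum_max n : 0 < n -> nu_sum n n = 1.
Proof.
move=> n0; pose l1 := IntPart (intpart1_subproof n0).
rewrite /nu_sum (bigD1 l1) //= big1 => [|l ll1]; first by rewrite /mult_k /= eqxx.
apply/count_memPn; apply: contra ll1 => /intpart_mem_max l_n.
by apply/eqP/val_inj.
Qed.

Theorem theorem1p3 (n : nat) (hn : 1 <= n) :
  [/\ lambda_sum n n = 1, nu_sum n n = 1 & gamma_sum n n = 1] /\
  (forall k : nat, 1 <= k <= n - 1 ->
     lambda_sum n k = nu_sum n k + lambda_sum n k.+1 /\
     nu_sum n k = gamma_sum n k + nu_sum n k.+1).
Proof.
have nu1 := nu_sum_max hn; split.
  split => //; first by rewrite lambda_sum_rec // nu1 lambda_sum_gt.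
  by rewrite -nu1 [RHS]nu_sum_rec // nu_sum_gt addn0.
by move=> k /andP[k0 _]; split; [apply: lambda_sum_rec | apply: nu_sum_rec].
Qed.
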